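(* Fix an integer $\Delta\ge 2$ and a real number $r>T_\Delta:=\frac{(\Delta-1)^{\Delta+1}}{\Delta^{\Delta}}$. There exists $\theta=\theta(\Delta,r)>0$ such that for every finite simple graph $G$ with maximum degree $\Delta(G)\le\Delta$, the domination polynomial $D(G,x)$ has no root $z$ satisfying $|z|\ge r$ and $|\arg(z)|<\theta$.
   Context: A set $S\subseteq V(G)$ is dominating if every vertex of $G$ is in $S$ or adjacent to a vertex of $S$. For a graph $G$ on $n$ vertices, $d_k(G)$ is the number of dominating sets of size $k$, and the domination polynomial is $D(G,x)=\sum_{k=0}^n d_k(G)x^k$. Here $\arg(z)\in(-\pi,\pi]$ denotes the principal argument of a nonzero complex number $z$. *)

(* Defs.v *)
From HB Require Import structures.
From mathcomp Require Import all_boot all_order all_algebra.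
From mathcomp Require Import complex.
From mathcomp Require Import boolp classical_sets reals trigo.

Set Implicit Arguments.
Unset Strict Implicit.
Unset Printing Implicit Defensive.

Import Order.TTheory GRing.Theory Num.Theory.

Local Open Scope ring_scope.
Local Open Scope complex_scope.

(* A finite simple graph is given by a symmetric irreflexive adjacency relation
   on a finite type of vertices. *)
Section Graph.

Variables (V : finType) (e : rel V).

Definition max_degree : nat := \max_(v : V) #|[set u | e v u]|.

Definition dominating (S : {set V}) : bool :=
  [forall v, (v \in S) || [exists u in S, e v u]].

Definition dom_count (k : nat) : nat :=
  #|[set S : {set V} | dominating S & #|S| == k]|.

Definition dom_poly (K : nzRingType) : {poly K} :=
  \sum_(k < #|V|.+1) (dom_count k)%:R *: 'X^k.

End Graph.

Section PrincipalArgument.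

Variable R : realType.
Implicit Types (z : R[i]) (t : R).

Definition is_principal_arg z t : Prop :=
  - pi < t <= pi /\ z = (Normc.normc z)%:C * (cos t +i* sin t).

(* The value at z = 0, where every angle qualifies, is unspecified. *)
Definition principal_arg z : R :=
  xget 0 [set t | is_principal_arg z t]%classic.

Lemma principal_argP z : z != 0 -> is_principal_arg z (principal_arg z).
Proof.
move=> z0; rewrite /principal_arg.
suff [t zt] : exists t, is_principal_arg z t by apply: (xgetI _ zt).
case: z z0 => a b z0.
have sq_ge0 : 0 <= a ^+ 2 + b ^+ 2 by rewrite addr_ge0 ?sqr_ge0.
pose n := Num.sqrt (a ^+ 2 + b ^+ 2).
have n2 : n ^+ 2 = a ^+ 2 + b ^+ 2 by rewrite sqr_sqrtr.
have n_gt0 : 0 < n.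
  rewrite lt_def sqrtr_ge0 andbT; apply: contra z0 => /eqP n0.
  by apply/eqP/Normc.eq0_normc.
have n0 : n != 0 by rewrite gt_eqF.
have ann : `|a / n| <= 1.
  rewrite normrM normfV (gtr0_norm n_gt0) ler_pdivrMr // mul1r.
  by rewrite -sqrtr_sqr ler_wsqrtr // lerDl sqr_ge0.
have an : -1 <= a / n <= 1 by rewrite -ler_norml.
have sinE : n * sin (acos (a / n)) = `|b|.
  rewrite sin_acos // -[X in X * _](gtr0_norm n_gt0) -!sqrtr_sqr -sqrtrM ?sqr_ge0 //.
  congr (Num.sqrt _); rewrite expr_div_n mulrBr mulr1 mulrCA divff ?expf_neq0 //.
  by rewrite mulr1 n2 addrAC subrr add0r.
have cosE : n * cos (acos (a / n)) = a.
  by rewrite acosK ?in_itv //= mulrC divfK.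
have acos0 := acos_ge0 an; have acospi := acos_lepi an.
have [b0|b0] := leP 0 b.
  exists (acos (a / n)); split.
    by rewrite acospi andbT (lt_le_trans _ acos0) // oppr_lt0 pi_gt0.
  by rewrite /= -/n; simpc; rewrite cosE sinE ger0_norm.
exists (- acos (a / n)); split; last first.
  by rewrite /= -/n; simpc; rewrite cosN sinN mulrN cosE sinE ltr0_norm ?opprK.
rewrite ltrN2 (le_trans _ (pi_ge0 R)) ?oppr_le0 // andbT.
rewrite lt_neqAle acospi andbT; apply/eqP => acosE.
by move: sinE; rewrite acosE sinpi mulr0 ltr0_norm // => /eqP;
  rewrite eq_sym oppr_eq0 lt_eqF.
Qed.

Lemma principal_arg_unique z t :
  z != 0 -> is_principal_arg z t -> principal_arg z = t.
Proof.
move=> z0 zt; have := principal_argP z0; move: (principal_arg z) => s zs.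
have n0 : (Normc.normc z)%:C != 0.
  by apply: contra z0 => /eqP[] /Normc.eq0_normc ->.
case: zs => /andP[s1 s2] zs; case: zt => /andP[t1 t2] zt.
have [cE sE] : cos s = cos t /\ sin s = sin t.
  by have := mulfI n0 (etrans (esym zs) zt) => -[].
have nE : `|s| = `|t|.
  have cos_norm u : cos `|u| = cos u :> R.
    by case: (ger0P u) => _ //; rewrite cosN.
  by apply: cos_inj; rewrite ?cos_norm // in_itv /= normr_ge0 ler_norml ltW.
have aux (u v : R) : - pi < u -> v <= pi -> sin u = sin v -> u = - v ->
    0 < v -> False.
  move=> u1 v2 uv uE v0; move: u1; rewrite uE ltrN2 => v1.
  have sv : 0 < sin v by rewrite sin_gt0_pi // v0.
  by move: uv; rewrite uE sinN => /eqP; rewrite lt_eqF // (lt_trans _ sv) ?oppr_lt0.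
move/eqP: nE; rewrite eqr_norm2 => /orP[/eqP //|/eqP sN].
have [t0|t0|t0] := ltgtP t 0.
- by case: (aux t s) => //; rewrite sN ?opprK ?oppr_gt0.
- by case: (aux s t).
- by rewrite sN t0 oppr0.
Qed.

End PrincipalArgument.

(* Main.v *)
(* A set is dominating iff it meets every closed neighbourhood, so D(G, z) is the
   generating polynomial of the transversals of a hypergraph in which every
   vertex lies in at most Delta + 1 edges. Deleting a vertex v expresses
   p = Z(B \ v, E) / Z(B, E) as q / (q + z) with q = prod_i (1 - p_i), where i
   runs over the edges through v and p_i is a product of ratios of the same kind
   for smaller vertex sets and vertices of degree at most Delta; only the very
   first vertex can have degree Delta + 1. It thus suffices to find a
   neighbourhood of [0, 1] that is closed under multiplication and under
   (p_1, ..., p_Delta) |-> q / (q + z). For real z, the map contracts lengths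
   measured by dx / sqrt (x (1 + x)) in the variable x = p / (1 - p), precisely
   when z > T_Delta: by Cauchy-Schwarz this amounts to
   (Delta * sum_i p_i - 1) * prod_i (1 - p_i) <= T_Delta, which is AM-GM. The
   sector |p - |p|| <= eps (1 - |p|) sqrt |p| is a thin tube in this metric, and
   the strict contraction leaves room for the second-order errors and for a
   small argument of z. *)
Require Import Defs.
From mathcomp Require Import all_boot all_order all_algebra.
From mathcomp Require Import complex.
From mathcomp Require Import reals topology normedtype trigo.
From mathcomp Require Import ring lra.

Set Implicit Arguments.
Unset Strict Implicit.
Unset Printing Implicit Defensive.

Import Order.TTheory GRing.Theory Num.Theory numFieldNormedType.Exports.
Local Open Scope ring_scope.

(** * Deletion recursions for the transversal polynomial of a hypergraph *)

Section TransversalPolynomial.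
Variables (V : finType) (K : fieldType) (z : K).
Implicit Types (B U e S : {set V}) (E F : seq {set V}) (v : V).

Definition hits E U := all (fun e : {set V} => ~~ [disjoint e & U]) E.

Definition transv B E : K := \sum_(U : {set V} | (U \subset B) && hits E U) z ^+ #|U|.

(** Counted with multiplicity: distinct vertices of a graph can share one closed neighbourhood, so
    the edges form a sequence. *)
Definition deg E v := count (fun e : {set V} => v \in e) E.

Lemma eq_transv B E F : E =i F -> transv B E = transv B F.
Proof. by move=> EF; apply: eq_bigl => U; rewrite /hits (eq_all_r EF). Qed.

(** Split the transversals by whether they contain [v]; those that do already meet every edge
    through [v]. *)
Lemma transvD1 B E v : v \in B ->
  transv B E = transv (B :\ v) E + z * transv (B :\ v) [seq e : {set V} <- E | v \notin e].
Proof.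
move=> vB; rewrite /transv (bigID (fun U : {set V} => v \notin U)) /=; congr (_ + _).
  apply: eq_bigl => U; rewrite subsetD1.
  by case: (U \subset B); case: (v \notin U); rewrite ?andbT ?andbF.
rewrite mulr_sumr.
rewrite (reindex_onto (fun U : {set V} => v |: U) (fun U => U :\ v)) /=; last first.
  by move=> U /andP[_]; rewrite negbK => /setD1K.
have disE e U : [disjoint e & v |: U] = (v \notin e) && [disjoint e & U].
  by rewrite -!setI_eq0 setIUr setU_eq0 [e :&: [set v]]setIC !setI_eq0 disjoints1.
have hitE U : hits E (v |: U) = hits [seq e : {set V} <- E | v \notin e] U.
  rewrite /hits all_filter; apply: eq_all => e /=; rewrite disE negb_and negbK.
  by rewrite implyNb.
apply: eq_big => [U|U].
  rewrite subUset sub1set vB hitE setU11 /= andbT subsetD1 -andbA andbC -andbA.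
  have -> : ((v |: U) :\ v == U) = (v \notin U).
    apply/eqP/idP => [<-|vU]; first by rewrite setD11.
    by rewrite setU1K.
  by case: (v \notin U); rewrite ?andbF //= andbT andbC.
case/andP=> _ /eqP UE; have vU : v \notin U by rewrite -UE setD11.
by rewrite cardsU1 vU exprS.
Qed.

(** The transversals of [E] that miss [e] are those contained in [B :\: e]. *)
Lemma transv_cons B e E : transv B (e :: E) = transv B E - transv (B :\: e) E.
Proof.
apply/eqP; rewrite eq_sym subr_eq; apply/eqP; rewrite /transv.
rewrite (bigID (fun U : {set V} => [disjoint e & U])) /= addrC; congr (_ + _).
  by apply: eq_bigl => U; rewrite /hits /= andbAC andbA.
apply: eq_bigl => U; rewrite subsetD [X in _ = (_ && X) && _]disjoint_sym.
by rewrite andbAC.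
Qed.

Variables (k : nat) (P : K -> Prop).
Hypotheses (P1 : P 1) (PM : forall p q, P p -> P q -> P (p * q)).

(** Delete the vertices of [S] one at a time; the ratio telescopes into a product, which stays in
    [P]. *)
Lemma transv_ratio_set B E S :
  (forall B' v, B' \subset B -> v \in B' -> v \in S ->
    exists2 p, P p & transv (B' :\ v) E = p * transv B' E) ->
  exists2 p, P p & transv (B :\: S) E = p * transv B E.
Proof.
have [n] := ubnP #|B :&: S|.
elim: n B => // n IH B; rewrite ltnS => leBn ratio.
have [BS0|/set0Pn[v /setIP[vB vS]]] := eqVneq (B :&: S) set0.
  by exists 1; rewrite // mul1r (setDidPl _) // -setI_eq0 BS0.
have [p Pp pE] := ratio B v (subxx B) vB vS.
have [|B' u sB'|q Pq qE] := IH (B :\ v).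
- rewrite setDE setIAC -setDE; apply: leq_trans (leBn).
  by apply: proper_card; rewrite properD1 // inE vB vS.
- by apply: ratio; apply: subset_trans sB' (subD1set _ _).
exists (q * p); first exact: PM.
rewrite -mulrA -pE -qE; congr transv.
by apply/setP=> u; rewrite !inE; case: eqVneq => [->|]; rewrite ?vS.
Qed.

(** An equation instead of a quotient: [transv B E] is not yet known to be nonzero. *)
Let ratioP B := forall E v, v \in B ->
  {in B, forall u, (deg E u <= k.+1)%N} -> (deg E v <= k)%N ->
  exists2 p, P p & transv (B :\ v) E = p * transv B E.

Let prodP n q := exists2 ps : seq K, (size ps = n /\ {in ps, forall p, P p})
                 & q = \prod_(p <- ps) (1 - p).

(** Restore the edges of [F] one by one. By [transv_cons], each edge contributes a factor [1 - p],
    where [p] is the ratio for deleting its vertices. *)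
Lemma transv_ratio_edges B E F : (forall B', B' \subset B -> ratioP B') ->
  {in B, forall u, (deg (F ++ E) u <= k.+1)%N} ->
  exists2 q, prodP (size F) q & transv B (F ++ E) = q * transv B E.
Proof.
move=> ratio; elim: F => [|e F IH] /= degB.
  by exists 1; [exists [::]; rewrite ?big_nil | rewrite mul1r].
have degF : {in B, forall u, (deg (F ++ E) u <= k.+1)%N}.
  by move=> u /degB; rewrite /deg /=; apply: leq_trans; rewrite leq_addl.
have [q [ps [szps Pps] qE] FE] := IH degF.
have [|p Pp pE] := @transv_ratio_set B (F ++ E) e.
  move=> B' v sB' vB' ve; apply: ratio => //.
    by move=> u /(subsetP sB'); apply: degF.
  (* The edge [e] through [v] is not yet present, which lowers the degree bound from [k.+1] to
     [k]. *)
  by have /degB := subsetP sB' v vB'; rewrite /deg /= ve ltnS.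
exists ((1 - p) * q); last by rewrite transv_cons pE FE; ring.
exists (p :: ps); last by rewrite big_cons qE.
split=> /=; first by rewrite szps.
by move=> x; rewrite inE => /predU1P[->|/Pps].
Qed.

Hypothesis step : forall ps : seq K, (size ps <= k)%N -> {in ps, forall p, P p} ->
  let q := \prod_(p <- ps) (1 - p) in q + z != 0 /\ P (q / (q + z)).

Lemma transv_split B E v : v \in B ->
  {in B, forall u, (deg E u <= k.+1)%N} ->
  (forall B', B' \subset B :\ v -> ratioP B') ->
  exists2 q, prodP (deg E v) q &
    let Ev := [seq e : {set V} <- E | v \notin e] in
    transv (B :\ v) E = q * transv (B :\ v) Ev /\
    transv B E = (q + z) * transv (B :\ v) Ev.
Proof.
move=> vB degB ratio.
pose Ev := [seq e : {set V} <- E | v \notin e]; pose F := [seq e : {set V} <- E | v \in e].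
have EF : perm_eq (F ++ Ev) E by rewrite perm_filterC.
have [|q Pq qE] := transv_ratio_edges (E := Ev) (F := F) ratio.
  move=> u /setD1P[_ /degB]; congr (_ <= _)%N.
  exact: (esym (permP EF _)).
exists q; first by rewrite /deg -size_filter.
move: qE; rewrite (eq_transv _ (perm_mem EF)) => qE; split=> //.
by rewrite (transvD1 _ vB) qE mulrDl.
Qed.

Lemma transv_ratio B : ratioP B.
Proof.
have [n] := ubnP #|B|; elim: n B => // n IH B; rewrite ltnS => leBn E v vB degB degv.
have [|q [ps [szps Pps] ->] /= [-> ->]] := transv_split vB degB.
  move=> B' sB'; apply: IH; apply: leq_trans leBn.
  exact: leq_ltn_trans (subset_leq_card sB') (proper_card (properD1 vB)).
have [|nz Pq] := step _ Pps; first by rewrite szps.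
by eexists; [exact: Pq | rewrite mulrA divfK].
Qed.

Hypothesis root_step : forall ps : seq K,
  (size ps <= k.+1)%N -> {in ps, forall p, P p} -> \prod_(p <- ps) (1 - p) + z != 0.

(** Peeling off vertices gives a product of factors [q + z]. The hypothesis [hits E B] survives each
    step and leaves no edge when [B] is empty, where the polynomial is 1. *)
Lemma transv_neq0 B E : {in B, forall u, (deg E u <= k.+1)%N} -> hits E B ->
  transv B E != 0.
Proof.
have [n] := ubnP #|B|; elim: n B E => // n IH B E; rewrite ltnS => leBn degB hitB.
have [B0|/set0Pn[v vB]] := eqVneq B set0.
  move: hitB; rewrite B0; case: E {degB} => [_|e E]; last by rewrite /hits /= -setI_eq0 setI0 eqxx.
  rewrite /transv (big_pred1 set0) ?cards0 ?expr0 ?oner_neq0 // => U.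
  by rewrite subset0 andbT.
have [q [ps [szps Pps] ->] /= [_ ->]] := transv_split vB degB (fun B' _ => @transv_ratio B').
rewrite mulf_neq0 //; first by apply: root_step Pps; rewrite szps degB.
apply: IH => [|u /setD1P[_ /degB]|].
- by apply: leq_trans leBn; rewrite (proper_card (properD1 vB)).
- by apply: leq_trans; rewrite /deg count_filter; apply: sub_count => e /andP[].
rewrite /hits all_filter; apply: sub_all hitB => e /= eB; apply/implyP=> ve.
by rewrite -setI_eq0 setIDA (setDidPl _) ?setI_eq0 // disjoint_sym disjoints1 inE (negPf ve).
Qed.

End TransversalPolynomial.

(** * A chord measure of the argument, and the sector of admissible ratios *)

Section Defect.
Variable R : rcfType.
Implicit Types (z w p : R[i]).
Local Notation normc := Normc.normc.
Local Notation Re := complex.Re.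
Local Notation Im := complex.Im.

Lemma normc_ge0 z : 0 <= normc z.
Proof. by case: z => a b; apply: sqrtr_ge0. Qed.

Lemma normc_sqr z : normc z ^+ 2 = Re z ^+ 2 + Im z ^+ 2.
Proof. by case: z => a b; rewrite /= sqr_sqrtr // addr_ge0 ?sqr_ge0. Qed.

Lemma Re_le_normc z : Re z <= normc z.
Proof.
apply: le_trans (ler_norm _) _; rewrite -ler_sqr ?nnegrE ?normc_ge0 //.
by rewrite normc_sqr real_normK ?num_real // lerDl sqr_ge0.
Qed.

Lemma normc_real (x : R) : normc x%:C%C = `|x|.
Proof. by rewrite /= expr0n addr0 sqrtr_sqr. Qed.

(** For nonzero [z] this is [|z|] times the chord from 1 to [z / |z|], that is
    [2 |z| |sin (arg z / 2)|]: a measure of the argument that avoids angles. *)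
Definition defect z : R := normc (z - (normc z)%:C%C).

Lemma defect_ge0 z : 0 <= defect z.
Proof. exact: normc_ge0. Qed.

Lemma sqr_defect z : defect z ^+ 2 = 2 * normc z * (normc z - Re z).
Proof.
rewrite /defect normc_sqr; have := normc_sqr z.
by case: z => a b; move: (normc _) => m /= mE; nra.
Qed.

Lemma Im_le_defect z : `|Im z| <= defect z.
Proof.
rewrite -ler_sqr ?nnegrE ?defect_ge0 // real_normK ?num_real // sqr_defect.
have := normc_sqr z; have := Re_le_normc z; nra.
Qed.

(** Chords are subadditive under multiplication, by the triangle inequality. *)
Lemma defectM z w : defect (z * w) <= normc z * defect w + normc w * defect z.
Proof.
rewrite /defect Normc.normcM rmorphM /=.
have -> : z * w - (normc z)%:C%C * (normc w)%:C%C
  = z * (w - (normc w)%:C%C) + (normc w)%:C%C * (z - (normc z)%:C%C) by ring.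
apply: le_trans (le_normcD _ _) _.
by rewrite !Normc.normcM normc_real ger0_norm ?normc_ge0.
Qed.

Lemma defectV z : z != 0 -> defect z^-1 = defect z / normc z ^+ 2.
Proof.
move=> z0; have m0 : normc z != 0 by apply: contra z0 => /eqP/Normc.eq0_normc->.
have mz : normc z > 0 by rewrite lt_def m0 normc_ge0.
apply/eqP; rewrite -(@eqrXn2 _ 2) ?divr_ge0 ?exprn_ge0 ?normc_ge0 ?defect_ge0 //.
rewrite expr_div_n !sqr_defect Normc.normcV.
have -> : Re z^-1 = Re z / normc z ^+ 2.
  by rewrite normc_sqr; case: (z).
by apply/eqP; field.
Qed.

(* tan arg w = Im w / Re w bounds the chord |w / |w| - 1|. *)
Lemma defect_le_Im w : 0 <= Re w -> Re w * defect w <= `|Im w| * normc w.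
Proof.
move=> w0; have m0 := normc_ge0 w; have xm := Re_le_normc w.
rewrite -ler_sqr ?nnegrE ?mulr_ge0 ?defect_ge0 //.
rewrite !exprMn real_normK ?num_real // sqr_defect.
have -> : Im w ^+ 2 = (normc w - Re w) * (normc w + Re w).
  by have := normc_sqr w; nra.
have h : 0 <= normc w * (normc w - Re w) by rewrite mulr_ge0 // subr_ge0.
have : 2 * Re w ^+ 2 <= normc w * (normc w + Re w) by nra.
by move/(ler_wpM2l h); nra.
Qed.

Variable eps : R.
Hypotheses (eps0 : 0 <= eps) (eps4 : 4 * eps <= 1).

Let eps1 : 0 <= 1 - eps.
Proof. by move: eps0 eps4; lra. Qed.

(* The condition says that the chord of p is at most
   eps * (|p|^(-1/2) - |p|^(1/2)), a superadditive function of -ln |p|. *)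
Definition sector p : Prop :=
  normc p <= 1 /\ defect p <= eps * (1 - normc p) * Num.sqrt (normc p).

Lemma sector1 : sector 1.
Proof.
by rewrite /sector /defect Normc.normc1 !subrr Normc.normc0 mulr0 mul0r.
Qed.

Lemma sector0 : sector 0.
Proof.
by rewrite /sector /defect Normc.normc0 subrr Normc.normc0 sqrtr0 mulr0.
Qed.

(** With [a] and [b] the square roots of the moduli, the slack left by [defectM] factors as
    [eps a b (1 - a b) (1 - a) (1 - b)], which is nonnegative. *)
Lemma sectorM p q : sector p -> sector q -> sector (p * q).
Proof.
case=> p1 dp [q1 dq]; rewrite /sector Normc.normcM.
have p0 := normc_ge0 p; have q0 := normc_ge0 q; split.
  by rewrite mulr_ile1.
apply: le_trans (defectM _ _) _; rewrite sqrtrM //.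
have := sqr_sqrtr p0; have := sqr_sqrtr q0.
have := sqrtr_ge0 (normc p); have := sqrtr_ge0 (normc q).
move: (Num.sqrt (normc p)) (Num.sqrt (normc q)) dp dq => a b dp dq b0 a0 bE aE.
move: dp dq; rewrite -aE -bE => dp dq.
have a1 : a <= 1 by rewrite -ler_sqr ?nnegrE // aE expr1n.
have b1 : b <= 1 by rewrite -ler_sqr ?nnegrE // bE expr1n.
have h1 := ler_wpM2l (sqr_ge0 a) dq; have h2 := ler_wpM2l (sqr_ge0 b) dp.
apply: le_trans (lerD h1 h2) _.
rewrite -subr_ge0.
have -> : eps * (1 - a ^+ 2 * b ^+ 2) * (a * b) - (a ^+ 2 * (eps * (1 - b ^+ 2) * b) +
  b ^+ 2 * (eps * (1 - a ^+ 2) * a)) = (eps * a * b) * ((1 - a * b) * ((1 - a) * (1 - b))).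
  by ring.
have ab1 : a * b <= 1 by rewrite mulr_ile1.
by rewrite !mulr_ge0 ?subr_ge0.
Qed.

(** The factor [1 - |p|] in the sector condition cancels against [Re (1 - p) >= 1 - |p|], so the
    chord of [1 - p] is only of order [eps * sqrt |p|]. *)
Lemma sector_1B p : sector p ->
  normc (1 - p) * (1 - eps) <= 1 - normc p /\
  defect (1 - p) <= eps * Num.sqrt (normc p) * normc (1 - p).
Proof.
have e0 := eps0; have e1 := eps1.
case=> p1 dp.
have t0 := normc_ge0 p; have m0 := normc_ge0 (1 - p); have a0 := sqrtr_ge0 (normc p).
have xt := Re_le_normc p; have wE := normc_sqr (1 - p).
have ReE : Re (1 - p) = 1 - Re p by case: (p).
have ImE : Im (1 - p) = - Im p by case: (p) => ? b /=; rewrite sub0r.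
split.
- rewrite -ler_sqr ?nnegrE ?mulr_ge0 ?(subr_ge0 (normc p)) //.
  have tx : 2 * (normc p - Re p) <= eps ^+ 2 * (1 - normc p) ^+ 2.
    have [t00|tp] := leP (normc p) 0.
      have /Normc.eq0_normc -> : normc p = 0 by apply/le_anti/andP.
      by rewrite Normc.normc0 /= subrr mulr0 mulr_ge0 // sqr_ge0.
    rewrite -(ler_pM2l tp).
    have -> : normc p * (2 * (normc p - Re p)) = defect p ^+ 2.
      by rewrite sqr_defect; ring.
    have : defect p ^+ 2 <= (eps * (1 - normc p) * Num.sqrt (normc p)) ^+ 2.
      by rewrite ler_sqr ?nnegrE ?defect_ge0 ?mulr_ge0 ?subr_ge0.
    by rewrite !exprMn sqr_sqrtr //; lra.
  (* [|1 - p|^2 = (1 - |p|)^2 + 2 (|p| - Re p)], and [tx] bounds the last term. *)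
  have E : normc (1 - p) ^+ 2 <= (1 + eps ^+ 2) * (1 - normc p) ^+ 2.
    have := normc_sqr p; move: wE; rewrite ReE ImE sqrrN => -> pE; nra.
  rewrite exprMn.
  have e2 : 0 <= (1 - eps) ^+ 2 by apply: sqr_ge0.
  apply: le_trans (ler_wpM2r e2 E) _.
  rewrite mulrAC ler_piMl ?sqr_ge0 //; nra.
(* If [Re (1 - p) <= 0], then [|p| = 1], the sector condition forces [p = 1], and both sides
   vanish. *)
- have [w0|w0] := ltP 0 (Re (1 - p)); last first.
    have t1 : normc p = 1 by lra.
    have d0 : defect p = 0.
      by apply/le_anti; rewrite defect_ge0 andbT; move: dp; rewrite t1 subrr mulr0 mul0r.
    have -> : p = 1 by have /eqP := Normc.eq0_normc d0; rewrite t1 subr_eq0 => /eqP.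
    rewrite subrr /defect Normc.normc0 subrr Normc.normc0.
    by rewrite mulr0.
  rewrite -(ler_pM2l w0); apply: le_trans (defect_le_Im (ltW w0)) _.
  rewrite ImE normrN mulrA; apply: ler_wpM2r => //.
  apply: le_trans (Im_le_defect _) _; apply: le_trans dp _.
  rewrite mulrCA -mulrA; apply: ler_wpM2l => //; apply: ler_wpM2r => //.
  by rewrite ReE; lra.
Qed.

Lemma sector_prod (ps : seq R[i]) : {in ps, forall p, sector p} ->
  let q := \prod_(p <- ps) (1 - p) in
  normc q * (1 - eps) ^+ size ps <= \prod_(p <- ps) (1 - normc p) /\
  defect q <= eps * (\sum_(p <- ps) Num.sqrt (normc p)) * normc q.
Proof.
elim: ps => [|p ps IH] Pps /=.
  by rewrite !big_nil Normc.normc1 /defect Normc.normc1 subrr Normc.normc0 !mulr1 mulr0.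
have [|nq dq] := IH; first by move=> x xps; apply: Pps; rewrite inE xps orbT.
have Pp : sector p by apply: Pps; rewrite inE eqxx.
have [n1 d1] := sector_1B Pp.
rewrite !big_cons Normc.normcM; split.
  by rewrite exprS mulrACA ler_pM ?mulr_ge0 ?exprn_ge0 ?normc_ge0.
apply: le_trans (defectM _ _) _.
have h1 := ler_wpM2l (normc_ge0 (1 - p)) dq.
have h2 := ler_wpM2l (normc_ge0 (\prod_(p <- ps) (1 - p))) d1.
apply: le_trans (lerD h1 h2) _; rewrite le_eqVlt; apply/orP; left; apply/eqP.
ring.
Qed.

(* Stability of the sector under R |-> R / (1 + R); the factor 1 - 4 eps absorbs
   all second-order terms. *)
Lemma sector_ratio (x : R[i]) (beta : R) :
  let s := normc x in
  defect x <= beta * s ->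
  Num.sqrt s * beta <= (1 - 4 * eps) * eps * Num.sqrt (1 + s) ->
  1 + x != 0 /\ sector (x / (1 + x)).
Proof.
have e0 := eps0; have e4 := eps4.
move=> s dx hb; have s0 : 0 <= s := normc_ge0 x.
have aE := sqr_sqrtr s0; have a0 := sqrtr_ge0 s.
have bE : Num.sqrt (1 + s) ^+ 2 = 1 + s by rewrite sqr_sqrtr // addr_ge0.
have b0 := sqrtr_ge0 (1 + s).
move: (Num.sqrt s) (Num.sqrt (1 + s)) hb aE a0 bE b0 => a b hb aE a0 bE b0.
have d0 := defect_ge0 x; have xs := Re_le_normc x; rewrite -/s in xs.
have b1 : 1 <= b by rewrite -ler_sqr ?nnegrE // bE expr1n lerDl.
have ab : a <= b by rewrite -ler_sqr ?nnegrE // aE bE; lra.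
have dab : defect x <= (1 - 4 * eps) * eps * (a * b).
  have := ler_wpM2l a0 hb; rewrite mulrA -expr2 aE; lra.
have sx : 2 * (s - Re x) <= eps ^+ 2 * b ^+ 2.
  have [s00|sp] := leP s 0.
    have /Normc.eq0_normc -> : normc x = 0 by apply/le_anti/andP.
    have -> : s = 0 by apply/le_anti/andP.
    by rewrite /= subrr mulr0 mulr_ge0 ?sqr_ge0.
  rewrite -(ler_pM2l sp).
  have -> : s * (2 * (s - Re x)) = defect x ^+ 2 by rewrite sqr_defect -/s; ring.
  have h : defect x <= eps * (a * b).
    by apply: le_trans dab _; apply: ler_wpM2r; [apply: mulr_ge0 | nra].
  have : defect x ^+ 2 <= (eps * (a * b)) ^+ 2.
    by rewrite ler_sqr ?nnegrE ?mulr_ge0.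
  by rewrite !exprMn aE; lra.
pose N := normc (1 + x); have N0 : 0 <= N := normc_ge0 _.
have NE : N ^+ 2 = (1 + s) ^+ 2 - 2 * (s - Re x).
  by rewrite /N normc_sqr; have := normc_sqr x; rewrite -/s; case: (x) => u v /=; nra.
have e1 : eps ^+ 2 <= 1 by nra.
have Nb : 1 + s - eps ^+ 2 <= N.
  rewrite -ler_sqr ?nnegrE //; last lra.
  rewrite NE; have := sx; rewrite bE; nra.
have Ns : 0 < N - s by nra.
have Np : 0 < N by lra.
have NleS : N <= 1 + s by rewrite -ler_sqr ?nnegrE ?addr_ge0 // NE; lra.
have x1 : 1 + x != 0.
  by apply/eqP => x10; move: Np; rewrite /N x10 Normc.normc0 ltxx.
split=> //; rewrite /sector /defect Normc.normcM Normc.normcV -/s -/N.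
split; first by rewrite ler_pdivrMr // mul1r; lra.
have NC : N%:C%C != 0 :> R[i] by rewrite eq_complex /= eqxx andbT gt_eqF.
(* The first term of the numerator is linear in the defect of [x]; the second comes from [|1 + x|]
   falling short of [1 + |x|] and is of second order ([sN]). *)
have -> : x / (1 + x) - (s / N)%:C%C =
   ((N - s)%:C%C * (x - s%:C%C) - (s * (1 + s - N))%:C%C) / ((1 + x) * N%:C%C).
  by rewrite !(rmorphM, rmorphB, rmorphD, fmorphV, rmorph1) /=; field; rewrite NC.
rewrite Normc.normcM Normc.normcV Normc.normcM normc_real (gtr0_norm Np) -/N.
have sN : s * (1 + s - N) <= defect x * eps.
  have h : (1 + s) * (1 + s - N) <= 2 * (s - Re x) by nra.
  have h2 : (1 + s) * (s * (1 + s - N)) <= defect x ^+ 2.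
    by rewrite sqr_defect -/s; have := ler_wpM2l s0 h; lra.
  have s1 : 0 < 1 + s by lra.
  rewrite -(ler_pM2l s1); apply: le_trans h2 _; rewrite expr2 mulrCA.
  apply: ler_wpM2l => //; apply: le_trans dab _.
  have : a * b <= 1 + s by rewrite -bE expr2 ler_wpM2r.
  have : 0 <= a * b by rewrite mulr_ge0.
  nra.
have num : normc ((N - s)%:C%C * (x - s%:C%C) - (s * (1 + s - N))%:C%C) <=
    defect x * (N - s + eps).
  apply: le_trans (le_normcD _ _) _.
  rewrite normcN Normc.normcM !normc_real (gtr0_norm Ns) -/(defect x) ger0_norm; last first.
    by rewrite mulr_ge0 // subr_ge0.
  rewrite -/(defect x) [defect x * _]mulrDr [defect x * (N - s)]mulrC lerD //.
rewrite ler_pdivrMr ?mulr_gt0 //; apply: le_trans num _.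
have nE := sqr_sqrtr N0; have n0 := sqrtr_ge0 N.
have aN : Num.sqrt (s / N) = a / Num.sqrt N.
  rewrite sqrtrM // sqrtrV //; congr (_ / _).
  by rewrite -aE sqrtr_sqr ger0_norm.
rewrite aN; have np : 0 < Num.sqrt N by rewrite sqrtr_gt0.
move: (Num.sqrt N) nE n0 np {aN} => n nE n0 np.
have -> : eps * (1 - s / N) * (a / n) * (N * N) = eps * a * ((N - s) * n).
  by rewrite -nE; field; rewrite gt_eqF.
have nb : b * (1 - eps ^+ 2) <= n.
  rewrite -ler_sqr ?nnegrE ?mulr_ge0 // ?subr_ge0 // exprMn nE bE.
  apply: le_trans Nb.
  have : 0 <= eps ^+ 2 by apply: sqr_ge0.
  nra.
(* The factor [1 - 4 eps] pays both for the extra [eps] from [num] and for the loss [1 - eps^2] in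
   [nb]. *)
have qe : (1 - 4 * eps) * (N - s + eps) <= (N - s) * (1 - eps ^+ 2).
  have : eps <= (1 - eps ^+ 2) * (4 * eps - eps ^+ 2) by nra.
  have : 1 - eps ^+ 2 <= N - s by lra.
  nra.
have Nse : 0 <= N - s + eps by lra.
apply: le_trans (ler_wpM2r Nse dab) _.
have -> : (1 - 4 * eps) * eps * (a * b) * (N - s + eps) =
  eps * a * (b * ((1 - 4 * eps) * (N - s + eps))) by ring.
apply: ler_wpM2l; first exact: mulr_ge0.
apply: le_trans (ler_wpM2l b0 qe) _.
by rewrite mulrCA; apply: ler_wpM2l => //; apply: ltW.
Qed.

End Defect.

(** * Real inequalities behind the threshold *)

Section RealInequalities.
Variable R : rcfType.

Lemma bernoulli_le (x : R) n : 0 <= x <= 1 -> 1 - n%:R * x <= (1 - x) ^+ n.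
Proof.
case/andP=> x0 x1; elim: n => [|n IH]; first by rewrite mul0r subr0.
rewrite exprS; have x1' : 0 <= 1 - x by lra.
apply: le_trans (ler_wpM2l x1' IH); rewrite -natr1.
have : 0 <= n%:R * (x * x) by rewrite mulr_ge0 // mulr_ge0.
nra.
Qed.

Lemma AGM_seq (xs : seq R) : {in xs, forall x, 0 <= x} ->
  \prod_(x <- xs) x * (size xs)%:R ^+ size xs <= (\sum_(x <- xs) x) ^+ size xs.
Proof.
move=> xs0; rewrite (big_nth 0) [in leRHS](big_nth 0) !big_mkord.
have [|+ _] := @leif_AGM_scaled R 'I_(size xs) predT (fun i => xs`_i).
  by move=> i _; rewrite mulrn_wge0 // xs0 // mem_nth.
rewrite cardT size_enum_ord; apply: le_trans.
rewrite le_eqVlt; apply/orP; left; apply/eqP.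
under [RHS]eq_bigr do rewrite -mulr_natr.
by rewrite big_split prodr_const cardT size_enum_ord.
Qed.

(** Cauchy-Schwarz, read off from the nonnegative sum of the squares [(n x - S)^2]. *)
Lemma sqr_sum_le (xs : seq R) :
  (\sum_(x <- xs) x) ^+ 2 <= (size xs)%:R * \sum_(x <- xs) x ^+ 2.
Proof.
case: xs => [|x0 xs]; first by rewrite !big_nil expr0n mul0r.
move: (x0 :: xs) (isT : 0 < size (x0 :: xs))%N => {x0 xs} xs n0.
set S := \sum_(x <- xs) x; set Q := \sum_(x <- xs) _; set n := (size xs)%:R.
have np : 0 < n :> R by rewrite ltr0n.
have : 0 <= \sum_(x <- xs) (n * x - S) ^+ 2 by apply: sumr_ge0 => x _; apply: sqr_ge0.
have -> : \sum_(x <- xs) (n * x - S) ^+ 2 = n * (n * Q - S ^+ 2).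
  rewrite (eq_bigr (fun x => n ^+ 2 * x ^+ 2 - 2 * n * S * x + S ^+ 2)); last first.
    by move=> x _; ring.
  rewrite big_split sumrB /= -!mulr_sumr -/S -/Q big_const_seq count_predT.
  by rewrite iter_addr_0 -mulr_natr -/n; ring.
by rewrite pmulr_rge0 // subr_ge0.
Qed.

(* AM-GM for the k numbers k (1 - t_i) together with k * (sum of the t_i) - 1;
   their sum is (k - 1) (k + 1). *)
Lemma prod_1B_le (k : nat) (ts : seq R) : (0 < k)%N -> size ts = k ->
  {in ts, forall t, 0 <= t <= 1} ->
  (k%:R * (\sum_(t <- ts) t) - 1) * \prod_(t <- ts) (1 - t)
    <= (k%:R - 1) ^+ k.+1 / k%:R ^+ k.
Proof.
move=> k0 szt ts01; set S := \sum_(t <- ts) t; set Pi := \prod_(t <- ts) _.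
have kp : 0 < k%:R :> R by rewrite ltr0n.
have k1 : 0 <= k%:R - 1 :> R by rewrite subr_ge0 ler1n.
have Pi0 : 0 <= Pi.
  rewrite /Pi big_seq; apply: prodr_ge0 => t /ts01 /andP[_ t1].
  by rewrite subr_ge0.
(* AM-GM needs nonnegative entries; if [k S - 1 <= 0], the left side is nonpositive anyway. *)
have [kS|kS] := leP (k%:R * S - 1) 0.
  by apply: le_trans (_ : 0 <= _); rewrite ?mulr_le0_ge0 ?divr_ge0 ?exprn_ge0 // ltW.
pose xs := (k%:R * S - 1) :: [seq k%:R * (1 - t) | t <- ts].
have szx : size xs = k.+1 by rewrite /= size_map szt.
have xs0 : {in xs, forall x, 0 <= x}.
  move=> x; rewrite inE => /predU1P[->|/mapP[t /ts01 /andP[_ t1] ->]]; first exact: ltW.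
  by rewrite mulr_ge0 ?subr_ge0 // ltW.
have := AGM_seq xs0; rewrite szx !big_cons !big_map.
have -> : \sum_(t <- ts) k%:R * (1 - t) = k%:R * (k%:R - S).
  by rewrite -mulr_sumr sumrB big_const_seq count_predT iter_addr_0 szt -/S.
have -> : \prod_(t <- ts) (k%:R * (1 - t)) = k%:R ^+ k * Pi.
  by rewrite big_split big_const_seq count_predT iter_mulr_1 szt.
have -> : k%:R * S - 1 + k%:R * (k%:R - S) = (k%:R - 1) * k.+1%:R :> R.
  by rewrite -natr1; ring.
rewrite exprMn ler_pM2r ?exprn_gt0 ?ltr0Sn // ler_pdivlMr ?exprn_gt0 //.
by rewrite -mulrA [Pi * _]mulrC.
Qed.

End RealInequalities.

(** * Invariance of the sector above the threshold, and absence of zeros *)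

Section ZeroFree.
Variables (R : realType) (k : nat) (r : R).
Local Notation normc := Normc.normc.

(** Cauchy-Schwarz replaces the squared sum by [k] times the sum of the moduli; the [- 1] in
    [prod_1B_le] then leaves the extra product on the right. *)
Lemma sector_sum_le (ps : seq R[i]) eps : (0 < k)%N -> size ps = k ->
  {in ps, forall p, sector eps p} ->
  (\sum_(p <- ps) Num.sqrt (normc p)) ^+ 2 * \prod_(p <- ps) (1 - normc p)
    <= (k%:R - 1) ^+ k.+1 / k%:R ^+ k + \prod_(p <- ps) (1 - normc p).
Proof.
move=> k0 szp Pps.
have ts01 : {in [seq normc p | p <- ps], forall t, 0 <= t <= 1}.
  by move=> _ /mapP[p /Pps [p1 _] ->]; rewrite normc_ge0.
have := prod_1B_le k0 _ ts01; rewrite size_map !big_map => /(_ szp) amgm.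
have := sqr_sum_le [seq Num.sqrt (normc p) | p <- ps]; rewrite size_map szp !big_map.
under [X in _ <= _ * X]eq_bigr do rewrite sqr_sqrtr ?normc_ge0 //.
have Pi0 : 0 <= \prod_(p <- ps) (1 - normc p).
  by rewrite big_seq; apply: prodr_ge0 => p /Pps [p1 _]; rewrite subr_ge0.
move/(ler_wpM2r Pi0) => h; apply: le_trans h _.
by rewrite -lerBlDr -[X in _ - X]mul1r -mulrBl.
Qed.

Variables (T eps : R).
Hypotheses (k0 : (0 < k)%N) (TE : (k%:R - 1) ^+ k.+1 / k%:R ^+ k = T).
Hypotheses (Tr : T < r) (eps0 : 0 < eps).
(* Chosen so that (1 - 8 eps)^2 (1 + r (1 - k eps)) >= 1 + T. *)
Hypothesis epsE : eps * (16 * (1 + r) + r * k%:R) <= r - T.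

Let T0 : 0 <= T.
Proof. by rewrite -TE divr_ge0 ?exprn_ge0 // subr_ge0 ler1n. Qed.

Let r0 : 0 < r. Proof. exact: le_lt_trans Tr. Qed.

Let epsk : eps * (16 + k%:R) <= 1.
Proof.
have kp : 0 <= k%:R :> R by [].
rewrite -(ler_pM2l r0).
move: T0 (eps0) epsE; rewrite mulr1; nra.
Qed.

Let eps16 : 16 * eps <= 1.
Proof.
have : 0 <= eps * k%:R by rewrite mulr_ge0 // ltW.
by move: epsk; lra.
Qed.

Let eps4 : 4 * eps <= 1. Proof. by move: eps16 eps0; lra. Qed.

Variable z : R[i].
Hypotheses (rz : r <= normc z) (dz : defect z <= 4 * eps ^+ 2 * normc z).

Let z0 : z != 0.
Proof.
by apply/eqP => zE; move: rz; rewrite zE Normc.normc0 leNgt r0.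
Qed.

Lemma defect_prod_div (ps : seq R[i]) : {in ps, forall p, sector eps p} ->
  defect ((\prod_(p <- ps) (1 - p)) / z) <=
    (4 * eps ^+ 2 + eps * \sum_(p <- ps) Num.sqrt (normc p)) *
      normc ((\prod_(p <- ps) (1 - p)) / z).
Proof.
move=> Pps; have [_ dq] := sector_prod (ltW eps0) eps4 Pps.
move: (\prod_(p <- _) _) (\sum_(p <- _) _) dq => q A dq.
have mz : 0 < normc z by apply: lt_le_trans rz.
rewrite Normc.normcM Normc.normcV; apply: le_trans (defectM _ _) _.
rewrite (defectV z0) Normc.normcV.
have h1 : defect z / normc z ^+ 2 <= 4 * eps ^+ 2 / normc z.
  rewrite ler_pdivrMr ?exprn_gt0 // [normc z ^+ 2]expr2 mulrA divfK ?gt_eqF //.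
have iz : 0 <= (normc z)^-1 by rewrite invr_ge0 ltW.
have := ler_wpM2l (normc_ge0 q) h1; have := ler_wpM2l iz dq; lra.
Qed.

(** With [x = q / z], the new ratio is [x / (1 + x)], so the task is to verify the hypotheses of
    [sector_ratio]. *)
Lemma sector_step (ps : seq R[i]) : (size ps <= k)%N ->
  {in ps, forall p, sector eps p} ->
  let q := \prod_(p <- ps) (1 - p) in q + z != 0 /\ sector eps (q / (q + z)).
Proof.
move=> szps Pps q.
(* Pad with zeros, which lie in the sector and contribute factors [1 - 0], since the AM-GM bound is
   for exactly [k] entries. *)
wlog szE : ps szps Pps @q / size ps = k.
  move=> /(_ (ps ++ nseq (k - size ps) 0)); rewrite size_cat size_nseq subnKC //.
  rewrite big_cat /= big_nseq iter_mulr_1 subr0 expr1n mulr1; apply=> //.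
  move=> p; rewrite mem_cat => /orP[/Pps//|/nseqP[-> _]].
  exact: sector0.
pose x := q / z; set A := \sum_(p <- ps) Num.sqrt (normc p).
have dx := defect_prod_div Pps; rewrite -/q -/x -/A in dx.
have A0 : 0 <= A by apply: sumr_ge0 => p _; apply: sqrtr_ge0.
have [qPi _] := sector_prod (ltW eps0) eps4 Pps.
rewrite -/q szE in qPi.
have APi := sector_sum_le k0 szE Pps; rewrite -/A TE in APi.
have Pi0 : 0 <= \prod_(p <- ps) (1 - normc p).
  by rewrite big_seq; apply: prodr_ge0 => p /Pps [p1 _]; rewrite subr_ge0.
have Pi1 : \prod_(p <- ps) (1 - normc p) <= 1.
  rewrite big_seq; apply: prodr_ile1 => p /Pps [p1 _].
  by rewrite subr_ge0 p1 lerBlDr lerDl normc_ge0.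
move: (\prod_(p <- ps) (1 - normc p)) APi Pi0 Pi1 qPi => Pi APi Pi0 Pi1 qPi.
set s := normc x; have s0 : 0 <= s := normc_ge0 x.
have qE : normc q = s * normc z.
  by rewrite /s /x -Normc.normcM divfK.
have kp : 0 <= k%:R :> R by [].
have e0 := ltW eps0; have e16 := eps16.
have ber : 1 - k%:R * eps <= (1 - eps) ^+ k by apply: bernoulli_le; rewrite e0; lra.
have e1 : 0 < 1 - k%:R * eps by move: epsk eps0; lra.
have sPi : s * (r * (1 - k%:R * eps)) <= Pi.
  apply: le_trans qPi; rewrite qE -mulrA; apply: ler_wpM2l => //.
  by apply: ler_pM => //; apply: ltW.
have rk0 : 0 < r * (1 - k%:R * eps) by apply: mulr_gt0.
set rk := r * _ in sPi rk0.
pose K := (1 - 8 * eps) ^+ 2.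
have K1 : K <= 1 by rewrite /K; nra.
have KT : 1 + T <= K * (1 + rk).
  have K16 : 1 - 16 * eps <= K by rewrite /K; move: (sqr_ge0 eps); lra.
  have : (1 - 16 * eps) * (1 + rk) <= K * (1 + rk).
    by apply: ler_wpM2r => //; rewrite addr_ge0 // ltW.
  apply: le_trans; rewrite /rk.
  have : 0 <= r * k%:R * (eps * eps) by exact: mulr_ge0 (mulr_ge0 (ltW r0) kp) (mulr_ge0 e0 e0).
  by move: epsE; lra.
(* The strict contraction: multiply by [Pi], use [A^2 Pi <= T + Pi] and [s rk <= Pi], then absorb
   [T] by [KT]. If [Pi = 0], then [s = 0]. *)
have sA : s * A ^+ 2 <= K * (1 + s).
  have [Pi00|Pip] := leP Pi 0.
    have -> : s = 0.
      by apply/le_anti; rewrite s0 andbT -(pmulr_lle0 _ rk0); apply: le_trans Pi00.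
    by rewrite mul0r addr0 mulr1 sqr_ge0.
  rewrite -(ler_pM2r Pip) -mulrA.
  apply: le_trans (ler_wpM2l s0 APi) _.
  have h1 : s * (T + 1 - K) <= s * (K * rk) by apply: ler_wpM2l => //; lra.
  have h2 : K * (s * rk) <= K * Pi by apply: ler_wpM2l => //; apply: sqr_ge0.
  have h3 : s * (1 - K) * Pi <= s * (1 - K) * 1.
    by apply: ler_wpM2l => //; rewrite mulr_ge0 // subr_ge0.
  lra.
(* The gap between [1 - 8 eps] and [1 - 4 eps] is what makes room for the term [4 eps^2] from the
   argument of [z]. *)
have hb : Num.sqrt s * (4 * eps ^+ 2 + eps * A) <= (1 - 4 * eps) * eps * Num.sqrt (1 + s).
  have a0 := sqrtr_ge0 s; have b0 := sqrtr_ge0 (1 + s).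
  have ab : Num.sqrt s <= Num.sqrt (1 + s) by apply: ler_wsqrtr; rewrite lerDr.
  have aA : Num.sqrt s * A <= (1 - 8 * eps) * Num.sqrt (1 + s).
    have e8 : 0 <= 1 - 8 * eps by lra.
    rewrite -ler_sqr ?nnegrE ?mulr_ge0 // !exprMn !sqr_sqrtr ?addr_ge0 //.
  have h1 := ler_wpM2l e0 aA.
  have h2 := ler_wpM2l (sqr_ge0 eps) ab.
  lra.
have [x1 Px] := sector_ratio e0 eps4 dx hb.
have qz : q + z = z * (1 + x) by rewrite /x mulrDr mulr1 mulrCA divff // mulr1 addrC.
by rewrite qz invfM mulrA mulf_neq0.
Qed.

(** If [q = - z], then [q / z = -1] has defect 2, whereas [k + 1] small chords and that of [z] add
    up to less. Only arguments matter, so one more factor does no harm. *)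
Lemma sector_root_step (ps : seq R[i]) : (size ps <= k.+1)%N ->
  {in ps, forall p, sector eps p} -> \prod_(p <- ps) (1 - p) + z != 0.
Proof.
move=> szps Pps; apply/eqP => /eqP; rewrite addr_eq0 => /eqP qE.
have := defect_prod_div Pps; rewrite /= qE mulNr divff //.
have n1 : normc (- 1 : R[i]) = 1 by rewrite normcN Normc.normc1.
have -> : defect (- 1 : R[i]) = 2.
  rewrite /defect n1 -opprD normcN (_ : 1 + 1 = (2 : R)%:C%C) ?normc_real ?ger0_norm //.
  by rewrite rmorphD rmorph1.
rewrite n1 mulr1; apply/negP; rewrite -ltNge.
have : \sum_(p <- ps) Num.sqrt (normc p) <= k%:R + 1.
  apply: (@le_trans _ _ (\sum_(p <- ps) 1)).
    rewrite big_seq [leRHS]big_seq; apply: ler_sum => p /Pps[p1 _].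
    by rewrite -sqrtr1 ler_wsqrtr.
  by rewrite big_const_seq count_predT iter_addr_0 natr1 ler_nat.
move/(ler_wpM2l (ltW eps0)).
have e0 := eps0; have ek := epsk; have e16 := eps16; have := sqr_ge0 eps; nra.
Qed.

Lemma transv_zero_free (V : finType) (B : {set V}) (E : seq {set V}) :
  {in B, forall u, (deg E u <= k.+1)%N} -> hits E B -> transv z B E != 0.
Proof.
apply: (transv_neq0 (P := sector eps)).
- exact: sector1.
- by move=> p q; apply: sectorM; apply: ltW.
- exact: sector_step.
- exact: sector_root_step.
Qed.

End ZeroFree.

(** * Passage from graphs to hypergraphs, and the choice of the angle *)

Section DominationPolynomial.
Variables (V : finType) (e : rel V).

Definition closed_nbhd v := [set u | (u == v) || e v u].

Lemma dom_polyE (K : fieldType) (z : K) :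
  (dom_poly e K).[z] = transv z [set: V] [seq closed_nbhd v | v <- enum V].
Proof.
rewrite /dom_poly horner_sum /transv.
have domE (U : {set V}) : hits [seq closed_nbhd v | v <- enum V] U = dominating e U.
  rewrite /hits all_map; apply/allP/forallP => [H v|H v _] /=.
    have := H v; rewrite mem_enum => /(_ isT) /=.
    rewrite -setI_eq0 => /set0Pn[u]; rewrite !inE => /andP[/orP[/eqP->->//|vu] uU].
    by apply/orP; right; apply/existsP; exists u; rewrite uU.
  rewrite -setI_eq0; apply/set0Pn.
  have /orP[vU|/existsP[u /andP[uU vu]]] := H v.
    by exists v; rewrite !inE eqxx.
  by exists u; rewrite !inE vu orbT.
rewrite (eq_bigl (dominating e)); last by move=> U; rewrite subsetT domE.
rewrite (partition_big (fun U : {set V} => inord #|U| : 'I_#|V|.+1) predT) //=.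
apply: eq_bigr => i _; rewrite hornerZ hornerXn /dom_count -sum1dep_card natr_sum mulr_suml.
apply: eq_big => [U|U /andP[_ /eqP->]]; last by rewrite mul1r.
by rewrite -val_eqE /= inordK // ltnS max_card.
Qed.

(** By symmetry, [u] lies in the closed neighbourhood of [v] exactly when [v] lies in that of [u],
    so the degree is [#|closed_nbhd u|]. *)
Lemma deg_closed_nbhd u : symmetric e ->
  (deg [seq closed_nbhd v | v <- enum V] u <= (max_degree e).+1)%N.
Proof.
move=> syme; rewrite /deg count_map.
have -> : count (preim closed_nbhd (fun N : {set V} => u \in N)) (enum V) = #|closed_nbhd u|.
  rewrite -sum1_count big_enum_cond -sum1_card; apply: eq_bigl => v.
  by rewrite !inE eq_sym syme.
have -> : closed_nbhd u = u |: [set v | e u v] by apply/setP=> v; rewrite !inE.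
rewrite cardsU1; apply: (@leq_add _ _ 1); first by case: (_ \notin _).
exact: (leq_bigmax u).
Qed.

End DominationPolynomial.

(** The squared defect is [2 |z|^2 (1 - cos (arg z))], so continuity of the cosine at 0 with
    tolerance [eta^2 / 2] suffices. *)
Lemma defect_le_arg (R : realType) (eta : R) : 0 < eta ->
  exists2 theta : R, 0 < theta & forall z : R[i], z != 0 ->
    `|principal_arg z| < theta -> defect z <= eta * Normc.normc z.
Proof.
move=> eta0; have e2 : 0 < eta ^+ 2 / 2 by rewrite divr_gt0 // exprn_gt0.
have := @continuous_cos R 0; rewrite /filter.continuous_at.
move=> /cvgrPdist_lt/(_ _ e2)/nbhs_ballP[theta theta0 H].
exists theta => // z z0 argz.
have [_ zE] := principal_argP z0.
have /= := H (principal_arg z); rewrite /ball /= sub0r normrN => /(_ argz).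
rewrite cos0; move: (cos _) (sin _) zE => c s zE.
rewrite ltr_norml => /andP[_ cb].
have m0 := normc_ge0 z.
rewrite -ler_sqr ?nnegrE ?defect_ge0 ?mulr_ge0 ?(ltW eta0) // sqr_defect.
have -> : complex.Re z = Normc.normc z * c by rewrite {1}zE /= mul0r subr0.
have h : 2 * (1 - c) <= eta ^+ 2 by lra.
have := ler_wpM2l (sqr_ge0 (Normc.normc z)) h; lra.
Qed.

Theorem theorem7 (R : realType) (Delta : nat) (hDelta : (2 <= Delta)%N)
    (r : R) (hr : (Delta%:R - 1) ^+ Delta.+1 / Delta%:R ^+ Delta < r) :
  exists2 theta : R, 0 < theta &
    forall (V : finType) (e : rel V), symmetric e -> irreflexive e ->
      (max_degree e <= Delta)%N ->
      forall z : R[i], root (dom_poly e R[i]) z ->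
        ~ (r <= Normc.normc z /\ `|principal_arg z| < theta).
Proof.
have k0 : (0 < Delta)%N by apply: ltnW.
set T := _ / _ in hr.
have T0 : 0 <= T by rewrite divr_ge0 ?exprn_ge0 // subr_ge0 ler1n.
have r0 : 0 < r by apply: le_lt_trans hr.
(* The largest [eps] that [transv_zero_free] allows; it depends only on [Delta] and [r], hence so
   does [theta]. *)
pose eps := (r - T) / (16 * (1 + r) + r * Delta%:R).
have den0 : 0 < 16 * (1 + r) + r * Delta%:R.
  by rewrite ltr_wpDr ?mulr_ge0 ?mulr_gt0 ?addr_gt0 // ltW.
have eps0 : 0 < eps by rewrite divr_gt0 ?subr_gt0.
have [|theta theta0 Htheta] := @defect_le_arg R (4 * eps ^+ 2).
  by rewrite mulr_gt0 ?exprn_gt0.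
exists theta => // V e syme irre degV z rootz [rz argz].
have z0 : z != 0 by apply/eqP => zE; move: rz; rewrite zE Normc.normc0 leNgt r0.
have := rootz; rewrite rootE dom_polyE; apply/negP.
apply: (transv_zero_free k0 (erefl _) hr eps0 _ rz).
- by rewrite divfK // gt_eqF.
- exact: Htheta.
- by move=> u _; apply: leq_trans (deg_closed_nbhd _ syme) _.
(* Each closed neighbourhood contains its centre, so the full vertex set is a transversal. *)
- rewrite /hits all_map; apply/allP => v _ /=; rewrite -setI_eq0 setIT.
  by apply/set0Pn; exists v; rewrite inE eqxx.
Qed.
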